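(* Let $k\geq 1$ be an integer and let $\Gamma$ be the group with generators $e_1,e_2,e_3,e_4,\alpha$ and defining relations $$[e_2,e_1]=[e_3,e_1]=[e_4,e_1]=[e_3,e_2]=[e_4,e_2]=1,\qquad [e_4,e_3]=e_1^{k},$$ $$\alpha e_1=e_1\alpha,\quad \alpha e_2=e_2\alpha,\quad \alpha e_3=e_2^{-1}e_3^{-1}\alpha,\quad \alpha e_4=e_4^{-1}\alpha,\quad \alpha^2=e_1.$$ Then $\mathrm{Spec}_R(\Gamma)=8\mathbb{N}\cup\{\infty\}$.
   Context: For a group $\Gamma$ and $\varphi\in\mathrm{Aut}(\Gamma)$, define $g\sim_\varphi g'$ iff there is $h\in\Gamma$ with $g=hg'\varphi(h)^{-1}$. The Reidemeister number $R(\varphi)\in\{1,2,3,\dots\}\cup\{\infty\}$ is the number of equivalence classes of $\sim_\varphi$, and $\mathrm{Spec}_R(\Gamma)=\{R(\varphi)\mid\varphi\in\mathrm{Aut}(\Gamma)\}$. Here $\mathbb{N}=\{1,2,3,\dots\}$ and $8\mathbb{N}=\{8n\mid n\in\mathbb{N}\}$. Commutators are $[a,b]=aba^{-1}b^{-1}$. *)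

(* Defs.v *)
From HB Require Import structures.
From mathcomp Require Import all_boot finmap.
From mathcomp Require Import boolp classical_sets functions cardinality.

Set Implicit Arguments.
Unset Strict Implicit.
Unset Printing Implicit Defensive.

Local Open Scope classical_set_scope.
Local Open Scope group_scope.
Local Open Scope quotient_scope.

(* Words in letters x (encoded (x, false)) and x^-1 (encoded (x, true)). *)
Section Words.
Variable X : Type.

Definition word := seq (X * bool).
Definition letter_inv (l : X * bool) : X * bool := (l.1, ~~ l.2).
Definition wgen (x : X) : word := [:: (x, false)].
Definition winv (w : word) : word := rev (map letter_inv w).
Definition wpow (w : word) (n : nat) : word := flatten (nseq n w).
(* This is a b a^-1 b^-1, unlike the library's [~ a, b] = a^-1 b^-1 a b. *)
Definition wcomm (a b : word) : word := a ++ b ++ winv a ++ winv b.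

End Words.

(* The group < X | rels >, where (u, v) in rels stands for the relation u = v:
   words modulo the least congruence for concatenation that contains the free
   cancellations and the relations. *)
Section Presentation.
Variables (X : choiceType) (rels : seq (word X * word X)).

Inductive word_eq : word X -> word X -> Prop :=
| word_eq_refl u : word_eq u u
| word_eq_sym u v : word_eq u v -> word_eq v u
| word_eq_trans u v w : word_eq u v -> word_eq v w -> word_eq u w
| word_eq_cat u u' v v' :
    word_eq u u' -> word_eq v v' -> word_eq (u ++ v) (u' ++ v')
| word_eq_cancel l : word_eq [:: l; letter_inv l] [::]
| word_eq_rel u v : (u, v) \in rels -> word_eq u v.

Definition word_eqb (u v : word X) : bool := `[< word_eq u v >].

Lemma word_eqb_refl : reflexive word_eqb.
Proof. by move=> u; apply/asboolP; exact: word_eq_refl. Qed.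

Lemma word_eqb_sym : symmetric word_eqb.
Proof.
by move=> u v; apply/idP/idP => /asboolP h; apply/asboolP; exact: word_eq_sym.
Qed.

Lemma word_eqb_trans : transitive word_eqb.
Proof.
move=> v u w /asboolP uv /asboolP vw; apply/asboolP.
exact: word_eq_trans uv vw.
Qed.

Canonical word_equiv :=
  EquivRel word_eqb word_eqb_refl word_eqb_sym word_eqb_trans.

Definition presented := {eq_quot word_equiv}.
HB.instance Definition _ := EqQuotient.on presented.
HB.instance Definition _ := Choice.on presented.

Definition pclass (u : word X) : presented := \pi u.

Lemma pclassP u v : pclass u = pclass v <-> word_eq u v.
Proof.
by split=> [/eqmodP/asboolP //|uv]; apply/eqmodP/asboolP.
Qed.

Lemma pclass_surj (g : presented) : exists u, g = pclass u.
Proof. by exists (repr g); rewrite /pclass reprK. Qed.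

Lemma word_eq_repr u : word_eq (repr (pclass u)) u.
Proof. by apply/pclassP; rewrite /pclass reprK. Qed.

Lemma letter_invK : involutive (@letter_inv X).
Proof. by case=> x b; rewrite /letter_inv /= negbK. Qed.

Lemma winvK : involutive (@winv X).
Proof.
by move=> w; rewrite /winv map_rev revK mapK //; exact: letter_invK.
Qed.

Lemma word_eq_mulV w : word_eq (w ++ winv w) [::].
Proof.
elim: w => [|l w IHw]; first exact: word_eq_refl.
have -> : (l :: w) ++ winv (l :: w) =
    [:: l] ++ (w ++ winv w) ++ [:: letter_inv l].
  by rewrite /winv /= rev_cons -cats1 catA.
apply: word_eq_trans (word_eq_cancel l).
apply: word_eq_cat (word_eq_refl [:: l]) _.
exact: word_eq_cat IHw (word_eq_refl [:: letter_inv l]).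
Qed.

Lemma word_eq_Vmul w : word_eq (winv w ++ w) [::].
Proof. by rewrite -{2}[w]winvK; exact: word_eq_mulV. Qed.

Lemma word_eq_inv u v : word_eq u v -> word_eq (winv u) (winv v).
Proof.
move=> uv; apply: (@word_eq_trans _ (winv u ++ v ++ winv v)).
  rewrite -{1}[winv u]cats0; apply: word_eq_cat; first exact: word_eq_refl.
  exact/word_eq_sym/word_eq_mulV.
rewrite catA -[X in word_eq _ X]cat0s.
apply: word_eq_cat; last exact: word_eq_refl.
apply: word_eq_trans (word_eq_Vmul u).
by apply: word_eq_cat; [exact: word_eq_refl|exact: word_eq_sym].
Qed.

Definition pmul (g h : presented) : presented := pclass (repr g ++ repr h).
Definition pone : presented := pclass [::].
Definition pinv (g : presented) : presented := pclass (winv (repr g)).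

Lemma pmul_class u v : pmul (pclass u) (pclass v) = pclass (u ++ v).
Proof. by apply/pclassP; apply: word_eq_cat; exact: word_eq_repr. Qed.

Lemma pinv_class u : pinv (pclass u) = pclass (winv u).
Proof. by apply/pclassP; apply: word_eq_inv; exact: word_eq_repr. Qed.

Lemma pmulA : associative pmul.
Proof.
move=> x y z; have [u ->] := pclass_surj x; have [v ->] := pclass_surj y.
by have [w ->] := pclass_surj z; rewrite !pmul_class catA.
Qed.

Lemma pmul1g : left_id pone pmul.
Proof. by move=> x; have [u ->] := pclass_surj x; rewrite pmul_class. Qed.

Lemma pmulg1 : right_id pone pmul.
Proof.
by move=> x; have [u ->] := pclass_surj x; rewrite pmul_class cats0.
Qed.

Lemma pmulVg : left_inverse pone pinv pmul.
Proof.
move=> x; have [u ->] := pclass_surj x; rewrite pinv_class pmul_class.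
exact/pclassP/word_eq_Vmul.
Qed.

Lemma pmulgV : right_inverse pone pinv pmul.
Proof.
move=> x; have [u ->] := pclass_surj x; rewrite pinv_class pmul_class.
exact/pclassP/word_eq_mulV.
Qed.

HB.instance Definition _ :=
  isGroup.Build presented pmulA pmul1g pmulg1 pmulVg pmulgV.

End Presentation.

Section Reidemeister.
Variable G : groupType.

Definition twisted_conj (phi : G -> G) (g g' : G) : Prop :=
  exists h : G, g = h * g' * (phi h)^-1.

Definition reidemeister_classes (phi : G -> G) : set (set G) :=
  [set [set g' | twisted_conj phi g g'] | g in [set: G]].

(* Elements of {1, 2, 3, ...} \cup {oo} are encoded in option nat,
   with None for oo. *)
Definition reidemeister_number (phi : G -> G) : option nat :=
  if `[< finite_set (reidemeister_classes phi) >]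
  then Some #|` fset_set (reidemeister_classes phi)|%fset
  else None.

(* A multiplicative map between groups is a group morphism, so that phi ranges
   over Aut(G). *)
Definition reidemeister_spectrum : set (option nat) :=
  [set reidemeister_number phi |
     phi in [set phi : {multiplicative G -> G} | bijective phi]].

End Reidemeister.

Inductive Gamma_gen := E1 | E2 | E3 | E4 | Alpha.

Definition Gamma_gen_code (x : Gamma_gen) : nat :=
  match x with E1 => 0 | E2 => 1 | E3 => 2 | E4 => 3 | Alpha => 4 end.
Definition Gamma_gen_decode (n : nat) : Gamma_gen :=
  match n with 0 => E1 | 1 => E2 | 2 => E3 | 3 => E4 | _ => Alpha end.
Lemma Gamma_gen_codeK : cancel Gamma_gen_code Gamma_gen_decode.
Proof. by case. Qed.
HB.instance Definition _ := Countable.copy Gamma_gen (can_type Gamma_gen_codeK).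

Definition Gamma_rels (k : nat) : seq (word Gamma_gen * word Gamma_gen) :=
  let e1 := wgen E1 in let e2 := wgen E2 in
  let e3 := wgen E3 in let e4 := wgen E4 in
  let alpha := wgen Alpha in
  [:: (wcomm e2 e1, [::]); (wcomm e3 e1, [::]); (wcomm e4 e1, [::]);
      (wcomm e3 e2, [::]); (wcomm e4 e2, [::]);
      (wcomm e4 e3, wpow e1 k);
      (alpha ++ e1, e1 ++ alpha);
      (alpha ++ e2, e2 ++ alpha);
      (alpha ++ e3, winv e2 ++ winv e3 ++ alpha);
      (alpha ++ e4, winv e4 ++ alpha);
      (wpow alpha 2, e1)].

Definition Gamma (k : nat) : groupType := presented (Gamma_rels k).

(* Main.v *)
From HB Require Import structures.
Require Import Defs.
From mathcomp Require Import all_boot all_algebra finmap.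
From mathcomp Require Import boolp classical_sets functions cardinality.
From mathcomp Require Import zify ring.

Set Implicit Arguments.
Unset Strict Implicit.
Unset Printing Implicit Defensive.

Import GRing.Theory Num.Theory.
Local Open Scope classical_set_scope.
Local Open Scope ring_scope.

(** Every element of Gamma is uniquely e1^x alpha^s e2^b e3^c e4^d with s in
   {0, 1}, so Gamma is isomorphic to an explicit group law on bool * int^4
   ([to_gamK], [of_gamK]).  Call s the parity, (c, d) the vector and
   B = 2 b - c the height of an element.

   Odd elements are the non-central elements with central square, so every
   automorphism phi keeps the parity.  The height spans Hom(Gamma, Z), so phi
   multiplies it by some eps = +-1.  Since e1 = alpha^2 and alpha has height 0,
   phi sends e1 to e1^delta with delta = +-1.  On vectors of even elements phi
   acts by an integer matrix M, and det M = delta because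
   [e4, e3] = e1^k ([automorphism_shape]).

   If eps = 1 the height is constant on twisted conjugacy classes; if the
   matrix s - M is singular for a sign s = +-1, a nonzero linear form in the
   vector takes at most two values on each class of even elements (s = 1) or of
   odd elements (s = -1); and if delta = 1 while 1 - M is regular, distinct
   powers of e1 lie in distinct classes.  In these cases R(phi) is infinite.

   There remain eps = delta = -1 and tr M <> 0, where det(s - M) = - s tr M.
   Twisted conjugation by even h alone brings an element to exactly one normal
   form, whose vector lies in a transversal of Z^2 / (s - M) Z^2, for the sign s
   of the element, and whose exponents x and b lie in {0, 1}; this makes
   2 * |tr M| * 4 normal forms.  An odd h never fixes an element under twisted
   conjugation ([odd_no_fixpoint]), so each class contains exactly two normal
   forms and R(phi) = 4 |tr M| ([reidemeister_number_trace]).  The height forces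
   the first row of M to be (odd, even), whence tr M is even and R(phi) is a
   multiple of 8.  The matrix with rows (1, 2) and (t, 2 t - 1) has determinant
   -1 and trace 2 t and comes from an automorphism, so every 8 t occurs. *)

(** * The group in coordinates *)

(** Gam k s x b c d stands for e1^x alpha^s e2^b e3^c e4^d.  Keeping the parity
   s of the exponent of alpha as a boolean makes the sign by which alpha acts
   on e3 and e4 compute. *)
Record gam (k : nat) := Gam
  { odd_part : bool; ex : int; eb : int; ec : int; ed : int }.

HB.instance Definition _ k := gen_eqMixin (gam k).
HB.instance Definition _ k := gen_choiceMixin (gam k).

Lemma Gam_eq k s x b c d s' x' b' c' d' :
  s = s' -> x = x' -> b = b' -> c = c' -> d = d' ->
  Gam k s x b c d = Gam k s' x' b' c' d'.
Proof. by move=> -> -> -> -> ->. Qed.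

Definition flip (s : bool) (z : int) : int := if s then - z else z.

Section Model.
Variable k : nat.
Implicit Types g h : gam k.

(** The summand 1 comes from alpha^2 = e1, and the summand with k from moving
   the e4-part of g past the e3-part of h. *)
Definition gmul g h : gam k :=
  Gam k (odd_part g (+) odd_part h)
    (ex g + ex h + (if odd_part g && odd_part h then 1 else 0)
       + k%:Z * (flip (odd_part h) (ed g) * ec h))
    ((if odd_part h then eb g - ec g else eb g) + eb h)
    (flip (odd_part h) (ec g) + ec h)
    (flip (odd_part h) (ed g) + ed h).

Definition gone : gam k := Gam k false 0 0 0 0.

Definition ginv g : gam k :=
  if odd_part g
  then Gam k true (- ex g - 1 + k%:Z * (ec g * ed g)) (ec g - eb g) (ec g) (ed g)
  else Gam k false (- ex g + k%:Z * (ec g * ed g)) (- eb g) (- ec g) (- ed g).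

Lemma gmulA : associative gmul.
Proof.
move=> [s x b c d] [s' x' b' c' d'] [s'' x'' b'' c'' d''].
by case: s; case: s'; case: s''; apply: Gam_eq => //=; ring.
Qed.

Lemma gmul1g : left_id gone gmul.
Proof. by move=> [[] x b c d]; apply: Gam_eq => //=; ring. Qed.

Lemma gmulg1 : right_id gone gmul.
Proof. by move=> [[] x b c d]; apply: Gam_eq => //=; ring. Qed.

Lemma gmulVg : left_inverse gone ginv gmul.
Proof. by move=> [[] x b c d]; apply: Gam_eq => //=; ring. Qed.

Lemma gmulgV : right_inverse gone ginv gmul.
Proof. by move=> [[] x b c d]; apply: Gam_eq => //=; ring. Qed.

HB.instance Definition _ :=
  isGroup.Build (gam k) gmulA gmul1g gmulg1 gmulVg gmulgV.

Lemma gmulE s x b c d s' x' b' c' d' :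
  (Gam k s x b c d * Gam k s' x' b' c' d')%g =
  Gam k (s (+) s')
    (x + x' + (if s && s' then 1 else 0) + k%:Z * (flip s' d * c'))
    ((if s' then b - c else b) + b') (flip s' c + c') (flip s' d + d').
Proof. by []. Qed.
End Model.

(** * Integer powers and presented groups *)

Section IntegerPowers.
Variable G : groupType.
Implicit Types (x y h : G) (n : int).

Definition zexp x n : G :=
  match n with Posz m => (x ^+ m)%g | Negz m => (x ^- m.+1)%g end.

Lemma zexpS x n : zexp x (n + 1) = (zexp x n * x)%g.
Proof.
case: n => [m|[|m]]; first by rewrite -PoszD addn1 /= expgSr.
  by rewrite /= expg1 mulVg.
have -> : Negz m.+1 + 1 = Negz m by lia.
by rewrite /= [(x ^+ m.+2)%g]expgS invgM mulgVK.
Qed.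

Lemma zexpB1 x n : zexp x (n - 1) = (zexp x n * x^-1)%g.
Proof. by rewrite -{2}[n](subrK 1) zexpS mulgK. Qed.

Lemma int_shift_ind (P : int -> Prop) :
  P 0 -> (forall n, P n -> P (n + 1)) -> (forall n, P n -> P (n - 1)) ->
  forall n, P n.
Proof.
move=> P0 PS Pp; elim/int_ind => // n IHn.
  by rewrite -addn1 PoszD; exact: PS.
have -> : - n.+1%:Z = - n%:Z - 1 by lia.
exact: Pp.
Qed.

Lemma zexpD x m n : zexp x (m + n) = (zexp x m * zexp x n)%g.
Proof.
elim/int_shift_ind: n => [|n IHn|n IHn]; first by rewrite addr0 mulg1.
  by rewrite addrA !zexpS IHn mulgA.
by rewrite addrA !zexpB1 IHn mulgA.
Qed.

Lemma zexpN x n : zexp x (- n) = ((zexp x n)^-1)%g.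
Proof. by apply/esym/mulg1_eq; rewrite -zexpD subrr. Qed.

(** The relations move a power of one generator past another generator, which
   turns the base x of the power into another base y. *)
Lemma zexp_swap x y h n : (x * h = h * y)%g -> (zexp x n * h = h * zexp y n)%g.
Proof.
move=> xh; have xVh : (x^-1 * h = h * y^-1)%g.
  by apply: (mulgI x); rewrite mulVKg mulgA xh mulgK.
elim/int_shift_ind: n => [|n IHn|n IHn]; first by rewrite mulg1 mul1g.
  by rewrite !zexpS -mulgA xh mulgA IHn mulgA.
by rewrite !zexpB1 -mulgA xVh mulgA IHn mulgA.
Qed.

Lemma commute_zexp x y n : commute x y -> commute (zexp x n) y.
Proof. exact: zexp_swap. Qed.

Lemma zexpMn x y n : commute x y -> zexp (x * y)%g n = (zexp x n * zexp y n)%g.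
Proof.
move=> xy; have xyn m : commute x (zexp y m).
  exact/commute_sym/commute_zexp/commute_sym.
elim/int_shift_ind: n => [|n IHn|n IHn]; first by rewrite mulg1.
  rewrite !zexpS IHn -!mulgA; congr (_ * _)%g.
  by rewrite mulgA -[(zexp y n * x)%g]xyn -mulgA.
rewrite !zexpB1 IHn invgM -!mulgA; congr (_ * _)%g; rewrite mulgA -zexpB1.
exact/commuteV/commute_sym/xyn.
Qed.

Lemma zexpA x m n : zexp (zexp x m) n = zexp x (m * n).
Proof.
elim/int_shift_ind: n => [|n IHn|n IHn]; first by rewrite mulr0.
  by rewrite zexpS IHn mulrDr mulr1 zexpD.
by rewrite zexpB1 IHn mulrBr mulr1 zexpD zexpN.
Qed.

Lemma zexpV x n : zexp (x^-1)%g n = zexp x (- n).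
Proof. by rewrite -[(x^-1)%g]/(zexp x (- 1)) zexpA mulN1r. Qed.

End IntegerPowers.

Section Morphisms.
Variables (G H : groupType) (f : {multiplicative G -> H}).

Lemma multiplicative1 : f 1%g = 1%g.
Proof. by apply: (mulgI (f 1%g)); rewrite -gmulfM !mulg1. Qed.

Lemma multiplicativeV x : f (x^-1)%g = ((f x)^-1)%g.
Proof. by apply/esym/mulg1_eq; rewrite -gmulfM mulgV multiplicative1. Qed.

Lemma multiplicative_zexp x n : f (zexp x n) = zexp (f x) n.
Proof.
elim/int_shift_ind: n => [|n IHn|n IHn]; first exact: multiplicative1.
  by rewrite !zexpS gmulfM IHn.
by rewrite !zexpB1 gmulfM IHn multiplicativeV.
Qed.

End Morphisms.

Section Evaluation.
Variables (X : choiceType) (rels : seq (word X * word X)).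
Variables (H : groupType) (f : X -> H).

Definition eval_letter (l : X * bool) : H := if l.2 then ((f l.1)^-1)%g else f l.1.
Fixpoint eval (w : word X) : H :=
  if w is l :: w' then (eval_letter l * eval w')%g else 1%g.

Lemma eval_cat u v : eval (u ++ v) = (eval u * eval v)%g.
Proof. by elim: u => [|l u IHu] /=; rewrite ?mul1g // IHu mulgA. Qed.

Lemma eval_wpow w n : eval (wpow w n) = (eval w ^+ n)%g.
Proof. by elim: n => // n IHn; rewrite expgS -IHn -eval_cat. Qed.

Hypothesis eval_rels : forall uv, uv \in rels -> eval uv.1 = eval uv.2.

Lemma eval_word_eq u v : word_eq rels u v -> eval u = eval v.
Proof.
elim=> {u v}.
- by [].
- by move=> u v _ ->.
- by move=> u v w _ -> _ ->.
- by move=> u u' v v' _ eu _ ev; rewrite !eval_cat eu ev.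
- by case=> x [] /=; rewrite /eval_letter /= mulg1 ?mulVg ?mulgV.
- by move=> u v /eval_rels.
Qed.

Definition presented_map (g : presented rels) : H := eval (repr g).

Lemma presented_map_class u : presented_map (pclass rels u) = eval u.
Proof. exact/eval_word_eq/word_eq_repr. Qed.

Lemma presented_mapM : {morph presented_map : g h / (g * h)%g}.
Proof.
move=> g h; have [u ->] := pclass_surj g; have [v ->] := pclass_surj h.
rewrite -[(_ * _)%g]/(pmul _ _) pmul_class !presented_map_class.
exact: eval_cat.
Qed.

End Evaluation.

Lemma eval_pclass (X : choiceType) (rels : seq (word X * word X)) (w : word X) :
  eval (fun x => pclass rels (wgen x)) w = pclass rels w.
Proof.
elim: w => [//|[x b] w /= ->].
have -> : eval_letter (fun x => pclass rels (wgen x)) (x, b) =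
          pclass rels [:: (x, b)].
  case: b => //; rewrite /eval_letter /=.
  exact: pinv_class.
exact: pmul_class.
Qed.

Lemma eval_presentation (X : choiceType) (rels : seq (word X * word X)) uv :
  uv \in rels ->
  eval (fun x => pclass rels (wgen x)) uv.1 = eval (fun x => pclass rels (wgen x)) uv.2.
Proof.
by case: uv => u v uv; rewrite !eval_pclass; apply/pclassP/word_eq_rel.
Qed.

(** * The normal form in Gamma *)

Definition gam_gen (k : nat) (i : Gamma_gen) : gam k :=
  match i with
  | E1 => Gam k false 1 0 0 0
  | E2 => Gam k false 0 1 0 0
  | E3 => Gam k false 0 0 1 0
  | E4 => Gam k false 0 0 0 1
  | Alpha => Gam k true 0 0 0 0
  end.

Lemma expg_e1 k n : (gam_gen k E1 ^+ n)%g = Gam k false n%:Z 0 0 0.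
Proof.
elim: n => // n IHn; rewrite expgS IHn gmulE.
by apply: Gam_eq => //=; rewrite ?addr0 ?mulr0 //; lia.
Qed.

Lemma gam_gen_rels k uv :
  uv \in Gamma_rels k -> eval (gam_gen k) uv.1 = eval (gam_gen k) uv.2.
Proof.
have invE (g : gam k) : (g^-1)%g = ginv g by [].
rewrite /Gamma_rels !in_cons in_nil orbF.
move=> /orP[/eqP -> | /orP[/eqP -> | /orP[/eqP -> | /orP[/eqP -> | /orP[/eqP -> |
  /orP[/eqP -> | /orP[/eqP -> | /orP[/eqP -> | /orP[/eqP -> | /orP[/eqP -> |
  /eqP ->]]]]]]]]]].
(* The sixth relation has the power e1^k, with a variable exponent, on its right. *)
6: rewrite [RHS]eval_wpow [eval _ (wgen E1)]mulg1 expg_e1.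
all: rewrite /= /eval_letter /= ?invE /ginv /= ?gmulE ?mulg1 //.
all: by apply: Gam_eq => //=; ring.
Qed.

Section NormalForm.
Variable k : nat.

Definition to_gam : Gamma k -> gam k :=
  @presented_map _ (Gamma_rels k) (gam k) (gam_gen k).

Lemma to_gamM : {morph to_gam : g h / (g * h)%g}.
Proof. exact/presented_mapM/gam_gen_rels. Qed.

HB.instance Definition _ :=
  isMultiplicative.Build (Gamma k) (gam k) to_gam to_gamM.

Definition gen (i : Gamma_gen) : Gamma k := pclass (Gamma_rels k) (wgen i).

Lemma to_gam_gen i : to_gam (gen i) = gam_gen k i.
Proof. by rewrite /to_gam (presented_map_class (@gam_gen_rels k)) /= mulg1. Qed.

Definition of_gam (g : gam k) : Gamma k :=
  (zexp (gen E1) (ex g) * gen Alpha ^+ odd_part g *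
   (zexp (gen E2) (eb g) * zexp (gen E3) (ec g) * zexp (gen E4) (ed g)))%g.

Lemma gen_rel uv : uv \in Gamma_rels k -> eval gen uv.1 = eval gen uv.2.
Proof. exact: eval_presentation. Qed.

Lemma commute_of_wcomm x y : (wcomm (wgen x) (wgen y), [::]) \in Gamma_rels k ->
  commute (gen x) (gen y).
Proof.
move=> /gen_rel; rewrite /= /eval_letter /= mulg1 -invgM mulgA.
by move/divg1_eq.
Qed.

Lemma gen_e1 : (gen Alpha * gen Alpha = gen E1)%g.
Proof.
have /gen_rel : (wpow (wgen Alpha) 2, wgen E1) \in Gamma_rels k by rewrite !inE eqxx !orbT.
by rewrite /= /eval_letter /= !mulg1.
Qed.

Lemma gen_alpha_e2 : commute (gen Alpha) (gen E2).
Proof.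
have /gen_rel : (wgen Alpha ++ wgen E2, wgen E2 ++ wgen Alpha) \in Gamma_rels k.
  by rewrite !inE eqxx !orbT.
by rewrite /= /eval_letter /= !mulg1.
Qed.

Lemma gen_alpha_e3 : (gen Alpha * gen E3 = (gen E2)^-1 * ((gen E3)^-1 * gen Alpha))%g.
Proof.
have /gen_rel : (wgen Alpha ++ wgen E3, winv (wgen E2) ++ winv (wgen E3) ++ wgen Alpha)
    \in Gamma_rels k by rewrite !inE eqxx !orbT.
by rewrite /= /eval_letter /= !mulg1.
Qed.

Lemma gen_alpha_e4 : (gen Alpha * gen E4 = (gen E4)^-1 * gen Alpha)%g.
Proof.
have /gen_rel : (wgen Alpha ++ wgen E4, winv (wgen E4) ++ wgen Alpha)
    \in Gamma_rels k by rewrite !inE eqxx !orbT.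
by rewrite /= /eval_letter /= !mulg1.
Qed.

Lemma gen_e43 : (gen E4 * gen E3 = zexp (gen E1) k * (gen E3 * gen E4))%g.
Proof.
have /gen_rel : (wcomm (wgen E4) (wgen E3), wpow (wgen E1) k) \in Gamma_rels k.
  by rewrite !inE eqxx !orbT.
rewrite [in RHS]/snd eval_wpow [eval _ (wgen E1)]mulg1.
rewrite /= /eval_letter /= mulg1 -invgM mulgA => h.
by apply/eqP; rewrite -divg_eq; apply/eqP.
Qed.

Lemma gen_central i : commute (gen E1) (gen i).
Proof.
by case: i => //; try (apply/commute_sym/commute_of_wcomm; by rewrite !inE eqxx ?orbT);
  rewrite /commute -gen_e1 mulgA.
Qed.

Lemma gen_e23 : commute (gen E2) (gen E3).
Proof. by apply/commute_sym/commute_of_wcomm; rewrite !inE eqxx ?orbT. Qed.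

Lemma gen_e24 : commute (gen E2) (gen E4).
Proof. by apply/commute_sym/commute_of_wcomm; rewrite !inE eqxx ?orbT. Qed.

(** Moving alpha to the front inverts e3 and e4 and turns each e3 into
   e3^-1 e2^-1. *)
Lemma lattice_alpha b c d :
  (zexp (gen E2) b * zexp (gen E3) c * zexp (gen E4) d * gen Alpha =
   gen Alpha *
     (zexp (gen E2) (b - c) * zexp (gen E3) (- c) * zexp (gen E4) (- d)))%g.
Proof.
have swap4 : (gen E4 * gen Alpha = gen Alpha * (gen E4)^-1)%g.
  by apply: (mulgI (gen E4)^-1%g); rewrite mulKg mulgA -gen_alpha_e4 mulgK.
have swap3 : (gen E3 * gen Alpha = gen Alpha * ((gen E2)^-1 * (gen E3)^-1))%g.
  rewrite -invgM -gen_e23; apply: (mulIg (gen E2 * gen E3)%g); rewrite mulgVK.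
  rewrite -mulgA [(gen Alpha * _)%g]mulgA gen_alpha_e2 -mulgA gen_alpha_e3.
  by rewrite !mulVKg.
rewrite -!mulgA (zexp_swap _ swap4) zexpV.
rewrite [(zexp (gen E3) c * _)%g]mulgA (zexp_swap _ swap3).
rewrite zexpMn; last first.
  exact/commuteV/commute_sym/commuteV/commute_sym/gen_e23.
rewrite !zexpV -!mulgA [LHS]mulgA (commute_zexp _ (commute_sym gen_alpha_e2)).
by rewrite zexpD !mulgA.
Qed.

Lemma of_gam_Alpha g : of_gam (g * gam_gen k Alpha)%g = (of_gam g * gen Alpha)%g.
Proof.
case: g => s x b c d; rewrite /of_gam gmulE /=.
rewrite !addr0 !mulr0 !addr0 -[RHS]mulgA lattice_alpha.
case: s => /=; last by rewrite addr0 mulg1 !mulgA.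
by rewrite zexpS -gen_e1 expg0 !expg1 mulg1 !mulgA.
Qed.

Lemma of_gam_E1 g : of_gam (g * gam_gen k E1)%g = (of_gam g * gen E1)%g.
Proof.
have -> : gam_gen k E1 = (gam_gen k Alpha * gam_gen k Alpha)%g.
  by rewrite gmulE; apply: Gam_eq => //=; ring.
by rewrite mulgA !of_gam_Alpha -mulgA gen_e1.
Qed.

Lemma of_gam_E2 g : of_gam (g * gam_gen k E2)%g = (of_gam g * gen E2)%g.
Proof.
case: g => s x b c d; rewrite /of_gam gmulE /= addbF andbF !mulr0 !addr0 zexpS.
rewrite -!mulgA; do 3 congr (_ * _)%g.
rewrite (commute_zexp d (commute_sym gen_e24)) !mulgA; congr (_ * _)%g.
by rewrite (commute_zexp c (commute_sym gen_e23)).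
Qed.

Lemma of_gam_E3 g : of_gam (g * gam_gen k E3)%g = (of_gam g * gen E3)%g.
Proof.
case: g => s x b c d.
rewrite /of_gam gmulE /= addbF andbF !mulr1 !addr0 !zexpS zexpD.
have swap : (gen E4 * gen E3 = gen E3 * (zexp (gen E1) k * gen E4))%g.
  by rewrite gen_e43 mulgA (commute_zexp _ (gen_central E3)) !mulgA.
rewrite -!mulgA (zexp_swap _ swap) zexpMn; last exact/commute_zexp/gen_central.
rewrite zexpA; congr (_ * _)%g.
set z := zexp (gen E1) _.
have past i n (y : Gamma k) : (z * (zexp (gen i) n * y) = zexp (gen i) n * (z * y))%g.
  rewrite !mulgA; congr (_ * _)%g.
  exact/commute_zexp/commute_sym/commute_zexp/commute_sym/gen_central.
by rewrite -[(gen Alpha ^+ s)%g]/(zexp (gen Alpha) s) -[gen E3 in LHS]/(zexp (gen E3) 1) !past.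
Qed.

Lemma of_gam_E4 g : of_gam (g * gam_gen k E4)%g = (of_gam g * gen E4)%g.
Proof.
case: g => s x b c d; rewrite /of_gam gmulE /= addbF andbF !mulr0 !addr0 zexpS.
by rewrite !mulgA.
Qed.

(** Right multiplication by the inverse of a generator needs no computation:
   it undoes right multiplication by that generator. *)
Lemma of_gam_letter g l :
  of_gam (g * eval_letter (gam_gen k) l)%g = (of_gam g * eval_letter gen l)%g.
Proof.
have gens i h : of_gam (h * gam_gen k i)%g = (of_gam h * gen i)%g.
  case: i; [exact: of_gam_E1|exact: of_gam_E2|exact: of_gam_E3|
            exact: of_gam_E4|exact: of_gam_Alpha].
case: l => i [] /=; rewrite /eval_letter /=; last exact: gens.
by apply: (mulIg (gen i)); rewrite -gens !mulgVK.
Qed.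

(** Reading a word from left to right, of_gam turns multiplication by a letter in
   coordinates into multiplication by the same letter in Gamma. *)
Lemma to_gamK : cancel to_gam of_gam.
Proof.
move=> g; have [w ->] := pclass_surj g.
rewrite /to_gam (presented_map_class (@gam_gen_rels k)) -eval_pclass.
suff main h : of_gam (h * eval (gam_gen k) w)%g = (of_gam h * eval gen w)%g.
  by rewrite -[eval _ w]mul1g main /of_gam /= !mulg1 mul1g.
elim: w h => [|l w IHw] h /=; first by rewrite !mulg1.
by rewrite mulgA IHw of_gam_letter mulgA.
Qed.

Lemma of_gamK : cancel of_gam to_gam.
Proof.
have powers i n : i != Alpha -> zexp (gam_gen k i) n =
   match i with
   | E1 => Gam k false n 0 0 0
   | E2 => Gam k false 0 n 0 0
   | E3 => Gam k false 0 0 n 0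
   | E4 => Gam k false 0 0 0 n
   | Alpha => 1%g
   end.
  case: i => // _; elim/int_shift_ind: n => // n IHn; rewrite ?zexpS ?zexpB1 IHn;
  by rewrite ?[(_^-1)%g]/(ginv _) /ginv /= gmulE; apply: Gam_eq => //=; ring.
have to_zexp g n : to_gam (zexp g n) = zexp (to_gam g) n.
  exact: (multiplicative_zexp to_gam).
case=> s x b c d; rewrite /of_gam /= !to_gamM !to_zexp.
rewrite -[(gen Alpha ^+ s)%g]/(zexp (gen Alpha) s) to_zexp.
have alphaE : zexp (gam_gen k Alpha) s = Gam k s 0 0 0 0 by case: s.
rewrite !to_gam_gen alphaE !powers // !gmulE.
by case: s {alphaE}; apply: Gam_eq => //=; ring.
Qed.

End NormalForm.

(** * Counting twisted conjugacy classes *)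

Section TwistedConjugacy.
Variables (G : groupType) (phi : {multiplicative G -> G}).

Lemma twisted_conjE (g g' h : G) :
  (g = h * g' * (phi h)^-1 <-> g * phi h = h * g')%g.
Proof. by split=> [->|<-]; rewrite ?mulgVK ?mulgK. Qed.

Lemma twisted_conjP (g g' : G) :
  twisted_conj phi g g' <-> exists h, (g * phi h = h * g')%g.
Proof. by split=> -[h] /twisted_conjE; exists h. Qed.

Lemma twisted_conj_refl g : twisted_conj phi g g.
Proof. by apply/twisted_conjP; exists 1%g; rewrite multiplicative1 mulg1 mul1g. Qed.

Lemma twisted_conj_sym g g' : twisted_conj phi g g' -> twisted_conj phi g' g.
Proof.
move=> /twisted_conjP[h gg']; apply/twisted_conjP; exists (h^-1)%g.
by rewrite multiplicativeV; apply: (mulgI h); rewrite mulVKg mulgA -gg' mulgK.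
Qed.

Lemma twisted_conj_trans g' g g'' :
  twisted_conj phi g g' -> twisted_conj phi g' g'' -> twisted_conj phi g g''.
Proof.
move=> /twisted_conjP[h gg'] /twisted_conjP[h' gg'']; apply/twisted_conjP.
by exists (h * h')%g; rewrite gmulfM mulgA gg' -mulgA gg'' mulgA.
Qed.

Lemma reidemeister_number_infinite (f : nat -> G) :
  (forall i j, twisted_conj phi (f i) (f j) -> i = j) ->
  reidemeister_number phi = None.
Proof.
move=> finj; rewrite /reidemeister_number asboolF //.
have cls_inj : {in [set: nat] &,
    injective (fun n => [set g' | twisted_conj phi (f n) g'])}.
  move=> i j _ _ e; apply: finj.
  have : [set g' | twisted_conj phi (f j) g'] (f j) by exact: twisted_conj_refl.
  by rewrite -e.
move=> fin; apply: infinite_nat; rewrite -(eq_finite_set (inj_card_eq cls_inj)).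
by apply: sub_finite_set fin => _ [n _ <-]; exists (f n).
Qed.

(** Sorting X by class partitions it into blocks of size m, one block for each
   class. *)
Lemma reidemeister_number_transversal (X : finType) (r : X -> G) (m : nat) :
  (0 < m)%N ->
  (forall g, #|[set x | `[< twisted_conj phi g (r x) >] ]%SET| = m) ->
  exists2 N, reidemeister_number phi = Some N & (N * m = #|X|)%N.
Proof.
move=> m0 fib; pose cl := reidemeister_classes phi.
pose blk (C : set G) : {set X} := [set x | `[< C (r x) >] ]%SET.
pose R x y := `[< twisted_conj phi (r x) (r y) >].
pose P := equivalence_partition R [set: X]%SET.
have RE : {in [set: X]%SET & &, equivalence_rel R}.
  move=> x y z _ _ _; split=> [|xy]; first exact/asboolP/twisted_conj_refl.
  apply/asboolP/asboolP; apply: twisted_conj_trans; move/asboolP: xy => //.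
  exact: twisted_conj_sym.
have surj g : exists x, twisted_conj phi g (r x).
  have /card_gt0P[x] : (0 < #|[set x | `[< twisted_conj phi g (r x) >] ]%SET|)%N.
    by rewrite fib.
  by rewrite inE => /asboolP; exists x.
have blkP : [set blk C | C in cl] = [set` P].
  apply/seteqP; split=> A /=.
    move=> [_ [g _ <-] <-]; have [x gx] := surj g.
    apply/imsetP; exists x; rewrite ?inE //; apply/setP => y.
    rewrite !inE; apply/asboolP/asboolP => /=; apply: twisted_conj_trans => //.
    exact: twisted_conj_sym.
  move=> /imsetP[x _ ->]; exists [set g' | twisted_conj phi (r x) g'].
    by exists (r x).
  by apply/setP => y; rewrite !inE.
have blk_inj : {in cl &, injective blk}.
  move=> C C'; rewrite !inE => -[g _ <-] [g' _ <-] /setP e.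
  have [x gx] := surj g; have /esym := e x; rewrite !inE [RHS]asboolT // => /asboolP g'x.
  have gg' := twisted_conj_trans gx (twisted_conj_sym g'x).
  apply/seteqP; split=> y /=; last exact: twisted_conj_trans.
  exact/twisted_conj_trans/twisted_conj_sym.
have finP : finite_set [set` P] by exact: finite_finset.
have eqP : ([set` P] #= cl)%card by rewrite -blkP; exact: inj_card_eq.
have fincl : finite_set cl by rewrite -(eq_finite_set eqP).
exists #|P|.
  rewrite /reidemeister_number asboolT //; congr Some.
  have -> : #|` fset_set cl|%fset = #|` fset_set [set` P]|%fset.
    by apply/fcard_eq => //; rewrite card_eq_sym.
  have -> : fset_set [set` P] = [fset A in P]%fset.
    by apply/fsetP => A; rewrite in_fset_set // !inE; apply/idP/idP; rewrite ?inE.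
  by rewrite card_imfset //= -cardE.
have partP := equivalence_partitionP RE.
rewrite -cardsT; apply/esym/(card_uniform_partition _ partP) => A.
move=> /imsetP[x _ ->]; rewrite -(fib (r x)); apply: eq_card => y.
by rewrite !inE.
Qed.

End TwistedConjugacy.

(** Conjugating an automorphism by an isomorphism carries twisted conjugacy
   classes bijectively to twisted conjugacy classes. *)
Lemma reidemeister_number_iso (G H : groupType)
    (f : {multiplicative G -> H}) (f' : H -> G) (phi : G -> G) (psi : H -> H) :
  cancel f f' -> cancel f' f -> (forall g, f (phi g) = psi (f g)) ->
  reidemeister_number phi = reidemeister_number psi.
Proof.
move=> fK f'K fphi.
have tc g g' : twisted_conj psi (f g) (f g') <-> twisted_conj phi g g'.
  split=> -[h e].
    exists (f' h); apply: (can_inj fK).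
    by rewrite !gmulfM multiplicativeV fphi f'K.
  by exists (f h); rewrite e !gmulfM multiplicativeV fphi.
have img : reidemeister_classes psi =
    [set (fun C => [set h | C (f' h)]) C | C in reidemeister_classes phi].
  apply/seteqP; split=> A /=.
    move=> [h _ <-]; exists [set g' | twisted_conj phi (f' h) g'].
      by exists (f' h).
    by apply/seteqP; split=> h' /=; rewrite -tc !f'K.
  move=> [_ [g _ <-] <-]; exists (f g) => //.
  by apply/seteqP; split=> h' /=; rewrite -tc !f'K.
have eqc : (reidemeister_classes psi #= reidemeister_classes phi)%card.
  rewrite img; apply: inj_card_eq => C C' _ _ /seteqP[s1 s2].
  apply/seteqP; split=> g Cg; rewrite -(fK g).
    by apply: s1; rewrite /= fK.
  by apply: s2; rewrite /= fK.
rewrite /reidemeister_number (eq_finite_set eqc).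
case: asboolP => // fin1; congr Some; apply/fcard_eq => //; last by rewrite card_eq_sym.
by rewrite (eq_finite_set eqc).
Qed.

Lemma reidemeister_spectrum_iso_sub (G H : groupType)
    (f : {multiplicative G -> H}) (f' : {multiplicative H -> G}) :
  cancel f f' -> cancel f' f ->
  reidemeister_spectrum G `<=` reidemeister_spectrum H.
Proof.
move=> fK f'K _ [phi phi_bij <-] /=.
exists (f \o phi \o f').
  apply: bij_comp; last by exists f.
  by apply: bij_comp => //; exists f'.
by apply/esym/(reidemeister_number_iso fK f'K) => g /=; rewrite fK.
Qed.

Lemma reidemeister_spectrum_iso (G H : groupType)
    (f : {multiplicative G -> H}) (f' : {multiplicative H -> G}) :
  cancel f f' -> cancel f' f ->
  reidemeister_spectrum G = reidemeister_spectrum H.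
Proof.
by move=> fK f'K; apply/seteqP; split; exact: reidemeister_spectrum_iso_sub.
Qed.

(** * Cosets of a planar lattice *)

(** A unimodular change of the parameters w1, w2 makes the matrix triangular
   with diagonal entries g = gcd(p, q) and y, where g y is the determinant; the
   pairs (i, j) with 0 <= i < |g| and 0 <= j < |y| then represent the cosets. *)
Lemma lattice_transversal (p q u v : int) (N : nat) :
  p * v - q * u != 0 -> N = absz (p * v - q * u)%R ->
  exists r : 'I_N -> int * int,
    (forall c d, exists i w1 w2,
        c = (r i).1 + (p * w1 + q * w2) /\ d = (r i).2 + (u * w1 + v * w2)) /\
    (forall i j w1 w2, (r i).1 = (r j).1 + (p * w1 + q * w2) ->
        (r i).2 = (r j).2 + (u * w1 + v * w2) -> i = j).
Proof.
move=> D0 NE; have [a [b ab]] := Bezoutz p q.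
have [/dvdzP[p' pE] /dvdzP[q' qE]] := (dvdz_gcdl p q, dvdz_gcdr p q).
move: (gcdz p q) ab pE qE => g ab pE qE.
pose y := p' * v - q' * u.
have DE : p * v - q * u = g * y by rewrite pE qE /y; ring.
have [g0 y0] : g != 0 /\ y != 0.
  by move: D0; rewrite DE mulf_eq0 negb_or => /andP[].
have ab1 : a * p' + b * q' = 1.
  by apply: (mulIf g0); rewrite mul1r -[RHS]ab pE qE; ring.
pose x := u * a + v * b.
have modlt (z m : int) : m != 0 -> (absz (z %% m)%Z < absz m)%N by move=> m0; lia.
pose I : finType := ('I_(absz g) * 'I_(absz y))%type.
have cardI : #|I| = N by rewrite card_prod !card_ord NE DE abszM.
pose r (ij : I) : int * int := ((ij.1 : nat)%:Z, (ij.2 : nat)%:Z).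
pose index (ij : I) := cast_ord cardI (enum_rank ij).
pose coset i : I := enum_val (cast_ord (esym cardI) i).
have indexK : cancel index coset.
  by move=> ij; rewrite /coset /index cast_ordK enum_rankK.
have coset_inj : injective coset by move=> i j /enum_val_inj/cast_ord_inj.
exists (r \o coset); split.
- move=> c d; pose s := (c %/ g)%Z; pose t := ((d - x * s) %/ y)%Z.
  exists (index (Ordinal (modlt c g g0), Ordinal (modlt (d - x * s) y y0))).
  exists (a * s - q' * t), (b * s + p' * t); rewrite /comp indexK /=.
  rewrite !gez0_abs ?modz_ge0 //; split.
    rewrite {1}(divz_eq c g) addrC; congr (_ + _).
    rewrite -/s -ab; move: s t => s t; rewrite pE qE; ring.
  have -> : u * (a * s - q' * t) + v * (b * s + p' * t) = x * s + t * y.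
    by rewrite /x /y; ring.
  have := divz_eq (d - x * s) y; rewrite -/t; lia.
- move=> l l' w1 w2 e1 e2; apply: coset_inj; move: e1 e2 => /=.
  move: (coset l) (coset l') => [i j] [i' j'] /= e1 e2.
  pose s := p' * w1 + q' * w2; pose t := a * w2 - b * w1.
  have e1' : (i : nat)%:Z = (i' : nat)%:Z + g * s by rewrite e1 pE qE /s; ring.
  have w1E : w1 = a * s - q' * t.
    by rewrite -[LHS]mul1r -ab1 /s /t; ring.
  have w2E : w2 = b * s + p' * t.
    by rewrite -[LHS]mul1r -ab1 /s /t; ring.
  have small (m z : int) (h h' : 'I_(absz m)) : m != 0 -> (h : nat)%:Z = (h' : nat)%:Z + m * z -> z = 0.
    move=> m0 e; have mz : (absz m * absz z < absz m)%N.
      rewrite -abszM; have -> : m * z = (h : nat)%:Z - (h' : nat)%:Z by rewrite e; ring.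
      by have := ltn_ord h; have := ltn_ord h'; lia.
    by move: mz; rewrite -{2}[absz m]muln1 ltn_pmul2l ?absz_gt0 // => ?; lia.
  have s0 := small _ _ _ _ g0 e1'.
  have e2' : (j : nat)%:Z = (j' : nat)%:Z + y * t by rewrite e2 w1E w2E s0 /y; ring.
  have t0 := small _ _ _ _ y0 e2'.
  congr (_, _); apply: val_inj => /=; first by move: e1'; rewrite s0; lia.
  by move: e2'; rewrite t0; lia.
Qed.

(** * The shape of an automorphism *)

Lemma int_unit (x y : int) : x * y = 1 -> x = 1 \/ x = -1.
Proof.
move=> /(congr1 absz) /eqP; rewrite abszM muln_eq1 => /andP[/eqP]; lia.
Qed.

Section Shape.
Variable k : nat.
Implicit Types g h : gam k.

(** The homomorphism to the integers that sends e2 to 2, e3 to -1 and the other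
   generators to 0. *)
Definition height g : int := 2 * eb g - ec g.
Definition central g := forall h, commute g h.

Lemma heightM g h : height (g * h)%g = height g + height h.
Proof.
by case: g => s x b c d; case: h => -[] x' b' c' d'; rewrite gmulE /height /=; ring.
Qed.

Lemma centralP g : central g <-> [/\ odd_part g = false, ec g = 0 & ed g = 0].
Proof.
split.
  case: g => s x b c d cg.
  have := cg (gam_gen k Alpha); have := cg (gam_gen k E3).
  rewrite /commute !gmulE /=.
  by case: s {cg} => -[? ? ? ?] [? ? ? ?]; split=> //; lia.
case: g => s x b c d [/= -> -> ->] [[] x' b' c' d'];
  by rewrite /commute !gmulE; apply: Gam_eq => //=; ring.
Qed.

(** Conjugation by an odd g acts by -1 on vectors, so they cancel in g^2; for
   height 0 the square is a power of e1. *)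
Lemma odd_square g : odd_part g ->
  (g * g)%g = Gam k false (2 * ex g + 1 - k%:Z * (ec g * ed g)) (height g) 0 0.
Proof.
by case: g => -[] //= x b c d _; rewrite gmulE; apply: Gam_eq => //=; rewrite /height /=; ring.
Qed.

(** This characterizes parity in terms of the group alone, so automorphisms
   preserve it. *)
Lemma odd_partP g : odd_part g <-> central (g * g)%g /\ ~ central g.
Proof.
split=> [og|[/centralP + ncg]].
  rewrite odd_square //; split; first exact/centralP.
  by move/centralP => [+ _ _]; rewrite og.
move: ncg; case: g => -[] // x b c d ncg; rewrite gmulE => -[/= _ c0 d0].
by case: ncg; apply/centralP; split=> //=; lia.
Qed.

(** The matrix M has rows (m, m') and (n, n') and acts on column vectors; the
   vector of phi alpha is (a1, a2). *)
Record aut_shape (phi : gam k -> gam k) (eps delta a1 a2 m m' n n' : int) : Prop := Shape {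
  shape_odd : forall g, odd_part (phi g) = odd_part g;
  shape_height : forall g, height (phi g) = eps * height g;
  shape_e1 : forall x, phi (Gam k false x 0 0 0) = Gam k false (delta * x) 0 0 0;
  shape_c : forall g, ec (phi g) = (if odd_part g then a1 else 0) + (m * ec g + m' * ed g);
  shape_d : forall g, ed (phi g) = (if odd_part g then a2 else 0) + (n * ec g + n' * ed g);
  shape_det : m * n' - m' * n = delta;
  shape_eps : eps = 1 \/ eps = - 1;
  shape_delta : delta = 1 \/ delta = - 1
}.

Lemma even_additive (F : gam k -> int) :
  (forall g h, ~~ odd_part g -> ~~ odd_part h -> F (g * h)%g = F g + F h) ->
  forall x b c d, F (Gam k false x b c d) =
    x * F (gam_gen k E1) + b * F (gam_gen k E2) + c * F (gam_gen k E3)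
      + d * F (gam_gen k E4).
Proof.
move=> FM x b c d.
have linear (f : int -> int) : (forall y z, f (y + z) = f y + f z) ->
    forall z, f z = z * f 1.
  move=> fD; have f0 : f 0 = 0 by have := fD 0 0; rewrite addr0; lia.
  elim/int_shift_ind => [|z IHz|z IHz]; first by rewrite f0 mul0r.
    by rewrite fD IHz; ring.
  by have := fD (z - 1) 1; rewrite subrK IHz => e; rewrite mulrBl mul1r e addrK.
have -> : Gam k false x b c d = (Gam k false x 0 0 0 * (Gam k false 0 b 0 0 *
    (Gam k false 0 0 c 0 * Gam k false 0 0 0 d)))%g.
  by rewrite !gmulE; apply: Gam_eq => //=; ring.
rewrite !FM // !addrA; congr (_ + _ + _ + _).
- apply: (linear (fun z => F (Gam k false z 0 0 0))) => y z; rewrite -FM //.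
  by rewrite gmulE; congr F; apply: Gam_eq => //=; ring.
- apply: (linear (fun z => F (Gam k false 0 z 0 0))) => y z; rewrite -FM //.
  by rewrite gmulE; congr F; apply: Gam_eq => //=; ring.
- apply: (linear (fun z => F (Gam k false 0 0 z 0))) => y z; rewrite -FM //.
  by rewrite gmulE; congr F; apply: Gam_eq => //=; ring.
- apply: (linear (fun z => F (Gam k false 0 0 0 z))) => y z; rewrite -FM //.
  by rewrite gmulE; congr F; apply: Gam_eq => //=; ring.
Qed.

(** The relations force F to vanish on alpha, e1 and e4 and to satisfy
   F e2 = - 2 F e3; killing e1 uses [e4, e3] = e1^k with k > 0. *)
Lemma additive_height (F : gam k -> int) : (0 < k)%N ->
  (forall g h, F (g * h)%g = F g + F h) ->
  forall g, F g = - F (gam_gen k E3) * height g.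
Proof.
move=> k0 FM; have lin := even_additive (fun g h _ _ => FM g h).
have e1 : F (gam_gen k E1) = 0.
  have : F (gam_gen k E4 * gam_gen k E3)%g = F (Gam k false k 0 1 1).
    by rewrite gmulE; congr F; apply: Gam_eq => //=; ring.
  rewrite FM lin => e; have /eqP : k%:Z * F (gam_gen k E1) = 0 by lia.
  by rewrite mulf_eq0 => /orP[|/eqP //]; lia.
have alpha : F (gam_gen k Alpha) = 0.
  have : F (gam_gen k Alpha * gam_gen k Alpha)%g = F (gam_gen k E1).
    by rewrite gmulE; congr F; apply: Gam_eq => //=; ring.
  by rewrite FM; lia.
have e4 : F (gam_gen k E4) = 0.
  have : F (gam_gen k E4 * gam_gen k Alpha * gam_gen k E4)%g = F (gam_gen k Alpha).
    by rewrite !gmulE; congr F; apply: Gam_eq => //=; ring.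
  by rewrite !FM; lia.
have e2 : F (gam_gen k E2) = - 2 * F (gam_gen k E3).
  have : F (gam_gen k E3 * gam_gen k Alpha * gam_gen k E3 * gam_gen k E2)%g =
      F (gam_gen k Alpha).
    by rewrite !gmulE; congr F; apply: Gam_eq => //=; ring.
  by rewrite !FM; lia.
move=> g; have -> : F g = F (Gam k false (ex g) (eb g) (ec g) (ed g)).
  case: g => -[] //= x b c d; rewrite -[RHS]add0r -{1}alpha -FM gmulE.
  by congr F; apply: Gam_eq => //=; ring.
by rewrite lin e1 e2 e4 /height; ring.
Qed.

Lemma zexp_gam_E1 n : zexp (gam_gen k E1) n = Gam k false n 0 0 0.
Proof.
elim/int_shift_ind: n => // n IHn; rewrite ?zexpS ?zexpB1 IHn;
  by rewrite ?[(_^-1)%g]/(ginv _) /ginv /= gmulE; apply: Gam_eq => //=; ring.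
Qed.

Section Automorphism.
Variable phi : {multiplicative gam k -> gam k}.
Hypotheses (k0 : (0 < k)%N) (phi_bij : bijective phi).

Lemma automorphism_central g : central (phi g) <-> central g.
Proof.
have [phi' phiK phi'K] := phi_bij; split=> cg h.
  by apply: (can_inj phiK); rewrite !gmulfM; exact: cg.
by rewrite -[h]phi'K /commute -!gmulfM cg.
Qed.

Lemma automorphism_odd g : odd_part (phi g) = odd_part g.
Proof.
by apply/idP/idP => /odd_partP og; apply/odd_partP; move: og;
  rewrite -!gmulfM !automorphism_central.
Qed.

(** Height and the powers of alpha^2 = e1 give eps and delta.  A central element
   has vector 0, so on even elements the vector of phi g depends only on, and
   additively on, the vector of g; applying phi to e4 e3 = e1^k e3 e4 and
   comparing e1-exponents gives the determinant. *)
Lemma automorphism_shape :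
  exists eps delta a1 a2 m m' n n', aut_shape phi eps delta a1 a2 m m' n n'.
Proof.
have [phi' phiK phi'K] := phi_bij.
pose eps := - height (phi (gam_gen k E3)).
pose A := phi (gam_gen k Alpha).
pose delta := 2 * ex A + 1 - k%:Z * (ec A * ed A).
have heightE g : height (phi g) = eps * height g.
  apply: (@additive_height (height \o phi) k0) => g1 g2 /=.
  by rewrite gmulfM heightM.
have phi1 : phi (gam_gen k E1) = Gam k false delta 0 0 0.
  have -> : gam_gen k E1 = (gam_gen k Alpha * gam_gen k Alpha)%g.
    by rewrite gmulE; apply: Gam_eq => //=; ring.
  rewrite gmulfM odd_square ?automorphism_odd // heightE.
  by apply: Gam_eq => //; rewrite /height /=; ring.
have phi1E x : phi (Gam k false x 0 0 0) = Gam k false (delta * x) 0 0 0.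
  by rewrite -zexp_gam_E1 multiplicative_zexp phi1 -!zexp_gam_E1 zexpA.
have vecE (w : gam k -> int) :
    (forall g h, w (g * h)%g = flip (odd_part h) (w g) + w h) ->
    (forall g, central g -> w g = 0) ->
    forall g, w (phi g) = (if odd_part g then w A else 0) +
      (w (phi (gam_gen k E3)) * ec g + w (phi (gam_gen k E4)) * ed g).
  move=> wM w0 g.
  have lin x b c d : w (phi (Gam k false x b c d)) =
      w (phi (gam_gen k E3)) * c + w (phi (gam_gen k E4)) * d.
    have wc : forall i, (i == E1) || (i == E2) -> w (phi (gam_gen k i)) = 0.
      by move=> i i12; apply/w0/automorphism_central/centralP; case: i i12.
    have wphiM g1 g2 : ~~ odd_part g1 -> ~~ odd_part g2 ->
        (w \o phi) (g1 * g2)%g = (w \o phi) g1 + (w \o phi) g2.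
      by move=> _ /negbTE og2; rewrite /comp gmulfM wM automorphism_odd og2.
    rewrite -[LHS]/((w \o phi) _) (even_additive wphiM) /comp (wc E1) ?(wc E2) //; ring.
  case: g => -[] x b c d /=; last by rewrite lin add0r.
  have -> : Gam k true x b c d = (gam_gen k Alpha * Gam k false x b c d)%g.
    by rewrite gmulE; apply: Gam_eq => //=; ring.
  by rewrite gmulfM wM automorphism_odd lin.
have cE : forall g, central g -> ec g = 0 by move=> g /centralP[].
have dE : forall g, central g -> ed g = 0 by move=> g /centralP[].
have eps_unit : eps = 1 \/ eps = - 1.
  have := heightE (phi' (gam_gen k E3)); rewrite phi'K.
  move: (height (phi' _)) (eps) => h eps0; rewrite /height /= => e.
  by apply: (@int_unit _ (- h)); lia.
exists eps, delta, (ec A), (ed A), (ec (phi (gam_gen k E3))), (ec (phi (gam_gen k E4))),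
  (ed (phi (gam_gen k E3))), (ed (phi (gam_gen k E4))).
split=> //.
- exact: automorphism_odd.
- exact: vecE.
- exact: vecE.
- have e43 : (gam_gen k E4 * gam_gen k E3)%g =
      (Gam k false k 0 0 0 * (gam_gen k E3 * gam_gen k E4))%g.
    by rewrite !gmulE; apply: Gam_eq => //=; ring.
  have := congr1 (fun g => ex (phi g)) e43; rewrite !gmulfM phi1E.
  have := automorphism_odd (gam_gen k E3); have := automorphism_odd (gam_gen k E4).
  case: (phi (gam_gen k E3)) => s3 x3 b3 m n; case: (phi (gam_gen k E4)) => s4 x4 b4 m' n'.
  move=> /= -> -> e.
  have kn0 : k%:Z != 0 by lia.
  by apply: (mulfI kn0); move: e; move: (delta) => dl; rewrite /flip /=; lia.
- have : central (phi' (gam_gen k E1)).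
    by apply/automorphism_central; rewrite phi'K; apply/centralP.
  have := heightE (phi' (gam_gen k E1)); have := phi'K (gam_gen k E1).
  case: (phi' (gam_gen k E1)) => s x b c d e + /centralP[/= s0 c0 d0].
  rewrite e /height /= c0 => h.
  have {h} /eqP : eps * b = 0 by move: (eps) h => z; lia.
  rewrite mulf_eq0 => /orP[/eqP|/eqP b0]; first by case: eps_unit; lia.
  by move: e; rewrite s0 c0 d0 b0 phi1E => -[/int_unit].
Qed.
End Automorphism.
End Shape.

(** * Infinite Reidemeister numbers *)

Lemma det_injective (p q u v w1 w2 : int) : p * v - q * u != 0 ->
  p * w1 + q * w2 = 0 -> u * w1 + v * w2 = 0 -> w1 = 0 /\ w2 = 0.
Proof.
move=> D0 e1 e2; split; apply: (mulfI D0); rewrite mulr0.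
  have -> : (p * v - q * u) * w1 = v * (p * w1 + q * w2) - q * (u * w1 + v * w2) by ring.
  by rewrite e1 e2; ring.
have -> : (p * v - q * u) * w2 = p * (u * w1 + v * w2) - u * (p * w1 + q * w2) by ring.
by rewrite e1 e2; ring.
Qed.

Section Classes.
Variables (k : nat) (phi : {multiplicative gam k -> gam k}).
Variables (eps delta a1 a2 m m' n n' : int).
Hypothesis sh : aut_shape phi eps delta a1 a2 m m' n n'.
Implicit Types g h : gam k.

Lemma twisted_parity g g' h : (g * phi h = h * g')%g -> odd_part g = odd_part g'.
Proof.
move=> /(congr1 (@odd_part k)).
have M (x y : gam k) : odd_part (x * y)%g = odd_part x (+) odd_part y by [].
by rewrite !M (shape_odd sh) addbC => /addbI.
Qed.

Lemma twisted_vector g g' h : (g * phi h = h * g')%g ->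
  flip (odd_part h) (ec g) + (if odd_part h then a1 else 0)
      + (m * ec h + m' * ed h) = flip (odd_part g) (ec h) + ec g' /\
  flip (odd_part h) (ed g) + (if odd_part h then a2 else 0)
      + (n * ec h + n' * ed h) = flip (odd_part g) (ed h) + ed g'.
Proof.
move=> e; rewrite (twisted_parity e) -!addrA -(shape_c sh) -(shape_d sh) -(shape_odd sh).
by split; [move: (congr1 (@ec k) e)|move: (congr1 (@ed k) e)].
Qed.

Lemma twisted_height g g' h : (g * phi h = h * g')%g ->
  height g + eps * height h = height h + height g'.
Proof. by move=> /(congr1 (@height k)); rewrite !heightM (shape_height sh). Qed.

(** Both h^2 and phi(h)^2 are powers of e1, on which phi acts by delta. *)
Lemma shape_square h : odd_part h -> height h = 0 ->
  2 * ex (phi h) + 1 - k%:Z * (ec (phi h) * ed (phi h)) =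
  delta * (2 * ex h + 1 - k%:Z * (ec h * ed h)).
Proof.
move=> oh h0; have := congr1 phi (odd_square oh).
rewrite gmulfM odd_square ?(shape_odd sh) // h0 (shape_e1 sh).
by move/(congr1 (@ex k)).
Qed.

Lemma infinite_height : eps = 1 -> reidemeister_number phi = None.
Proof.
move=> eps1; apply: (@reidemeister_number_infinite _ _ (fun i => Gam k false 0 i%:Z 0 0)).
move=> i j /twisted_conjP[h /twisted_height]; rewrite eps1 /height /=; lia.
Qed.

(** A linear form u <> 0 with u M = sg u takes at most two values z and u(a) - z
   on the vectors along a twisted conjugacy class of elements of parity s, where
   a is the vector of phi alpha. *)
Lemma infinite_singular (s : bool) :
  (flip s 1 - m) * (flip s 1 - n') - m' * n = 0 -> reidemeister_number phi = None.
Proof.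
set sg := flip s 1 => D0.
have [u1 [u2 [e1 e2 u0]]] : exists u1 u2, [/\ u1 * m + u2 * n = sg * u1,
    u1 * m' + u2 * n' = sg * u2 & 0 < u1 * u1 + u2 * u2].
  have pos (x y : int) : (x != 0) || (y != 0) -> 0 < x * x + y * y.
    have sq (z : int) : (0 <= z * z) * (z != 0 -> 0 < z * z).
      by split=> [|z0]; rewrite -expr2 ?sqr_ge0 // exprn_even_gt0.
    have [[x0 x1] [y0 y1]] := (sq x, sq y).
    by case/orP => [/x1|/y1]; lia.
  have [nz|] := boolP ((n != 0) || (sg - m != 0)).
    by exists n, (sg - m); split; [ring|lia|exact: pos].
  rewrite negb_or !negbK => /andP[/eqP n0 /eqP m0].
  have [nz|] := boolP ((sg - n' != 0) || (m' != 0)).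
    by exists (sg - n'), m'; split; [rewrite n0; lia|ring|exact: pos].
  rewrite negb_or !negbK => /andP[/eqP n'0 /eqP m'0].
  by exists 1, 0; split=> //; lia.
pose A := u1 * a1 + u2 * a2.
(* Multiples of u that are this large give values z > |u(a)|, so that no two of
   them sum to u(a). *)
pose N i : int := (absz A + 1 + i)%N%:Z.
apply: (@reidemeister_number_infinite _ _ (fun i => Gam k s 0 0 (N i * u1) (N i * u2))).
move=> i j /twisted_conjP[h /twisted_vector[/= v1 v2]].
have flipE z : flip s z = sg * z by rewrite /sg; case: (s) => /=; ring.
rewrite !flipE in v1 v2.
set q := u1 * u1 + u2 * u2 in u0.
have : flip (odd_part h) (N i * q) + (if odd_part h then A else 0) = N j * q.
  have -> : N j * q = u1 * (N j * u1) + u2 * (N j * u2) by rewrite /q; ring.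
  have := congr1 (fun z => u1 * z) v1; have := congr1 (fun z => u2 * z) v2.
  have := congr1 (fun z => z * ec h) e1; have := congr1 (fun z => z * ed h) e2.
  by rewrite /A /q; case: (odd_part h) => /=; lia.
case: (odd_part h) => /= e; last first.
  have : N i = N j by apply: (mulIf (lt0r_neq0 u0)); rewrite -e addr0.
  by rewrite /N; lia.
have AE : A = (N i + N j) * q by lia.
have : 0 <= (N i + N j) * (q - 1) by apply: mulr_ge0; rewrite /N; lia.
have : (N i + N j) * (q - 1) = A - (N i + N j) by rewrite AE; ring.
by rewrite /N; lia.
Qed.

(** If e1^i phi(h) = h e1^j with h odd, then height h = 0 and squaring gives
   i = j; if h is even, then 1 - M kills its vector, so that for regular 1 - M
   the element h is a power of e1, which phi fixes. *)
Lemma infinite_central : delta = 1 -> eps = - 1 -> reidemeister_number phi = None.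
Proof.
move=> delta1 eps1.
have [D0|D0] := eqVneq ((1 - m) * (1 - n') - m' * n) 0.
  exact: (@infinite_singular false).
apply: (@reidemeister_number_infinite _ _ (fun i => Gam k false i%:Z 0 0 0)).
move=> i j /twisted_conjP[h e].
have := twisted_height e; rewrite eps1 /height /= => h0.
have {}h0 : height h = 0 by rewrite /height; lia.
case oh: (odd_part h).
  have oph : odd_part (phi h) by rewrite (shape_odd sh).
  have := shape_square oh h0; move: e oh oph; rewrite delta1.
  case: (phi h) => s' x' b' c' d'; case: (h) => s x b c d e /= os os'.
  move: e; rewrite os os' !gmulE => -[/= e _ ce de]; have {ce}-> : c' = c by lia.
  by have {de}-> : d' = d; lia.
have [/= v1 v2] := twisted_vector e.
rewrite oh /= in v1 v2.
have [c0 d0] : ec h = 0 /\ ed h = 0.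
  by apply: (@det_injective (1 - m) (- m') (- n) (1 - n')); [lia|lia|lia].
have hE : h = Gam k false (ex h) 0 0 0.
  by move: oh c0 d0 h0; rewrite /height; case: (h) => s x b c d /= -> -> -> ?; apply: Gam_eq; lia.
move: e; rewrite hE (shape_e1 sh) !gmulE => /(congr1 (@ex k)) /=; lia.
Qed.
End Classes.

(** * Finite Reidemeister numbers *)

Section FiniteCount.
Variables (k : nat) (phi : {multiplicative gam k -> gam k}).
Variables (a1 a2 m m' n n' : int).
Hypothesis sh : aut_shape phi (- 1) (- 1) a1 a2 m m' n n'.
Implicit Types g h : gam k.

Definition twists h g g' := (g * phi h = h * g')%g.

Lemma twists_comp g g' g'' h h' :
  twists h g g' -> twists h' g g'' -> twists (h^-1 * h')%g g' g''.
Proof.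
rewrite /twists => e e'; rewrite gmulfM multiplicativeV -mulgA -e'.
by apply: (mulgI h); rewrite !mulgA -e mulgK mulgV mul1g.
Qed.

Lemma twists_trans g g' g'' h h' :
  twists h g g' -> twists h' g' g'' -> twists (h * h')%g g g''.
Proof. by rewrite /twists => e e'; rewrite gmulfM mulgA e -mulgA e' mulgA. Qed.

Lemma odd_partM g h : odd_part (g * h)%g = odd_part g (+) odd_part h.
Proof. by []. Qed.

Lemma odd_partV g : odd_part (g^-1)%g = odd_part g.
Proof. by rewrite [(_^-1)%g]/(ginv g) /ginv; case: g => -[]. Qed.

(** If h fixed g, then h^2 = e1^z with z odd, and comparing g phi(h^2) with
   h^2 g would give - z = z. *)
Lemma odd_no_fixpoint g h : odd_part h -> ~ twists h g g.
Proof.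
move=> oh e; have h0 : height h = 0.
  by have := twisted_height sh e; lia.
have := twists_trans e e; rewrite /twists odd_square // h0 (shape_e1 sh).
move: h0; rewrite /height; case: g {e} => s x b c d; case: (h) => s' x' b' c' d' /= h0.
rewrite !gmulE => /(congr1 (@ex k)) /=; have -> : c' = 2 * b' by lia.
have -> : k%:Z * (2 * b' * d') = 2 * (k%:Z * b' * d') by ring.
by case: s => /=; lia.
Qed.

(** The heights of phi e3 and phi e4 make m odd and m' even, and then
   det M = -1 makes n' odd. *)
Lemma trace_even : exists t, m + n' = 2 * t.
Proof.
have := shape_height sh (gam_gen k E3); have := shape_height sh (gam_gen k E4).
rewrite {1 3}/height !(shape_c sh) /height /= !mulr0 !mulr1 !add0r addr0.
move: (eb (phi _)) (eb (phi _)) => q p e4 e3.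
have n'_odd : m * n' - 2 * p * n = - 1.
  by have := shape_det sh; have -> : m' = 2 * p by lia.
have mE : m = 2 * q - 1 by lia.
exists (q * n' - p * n + q); move: n'_odd; rewrite mE; lia.
Qed.

Hypothesis trace_neq0 : m + n' != 0.

Definition trace_abs := absz (m + n')%R.

Lemma vector_transversal (s : bool) : exists r : 'I_trace_abs -> int * int,
  (forall c d, exists i w1 w2,
      c = (r i).1 + ((flip s 1 - m) * w1 + - m' * w2) /\
      d = (r i).2 + (- n * w1 + (flip s 1 - n') * w2)) /\
  (forall i j w1 w2,
      (r i).1 = (r j).1 + ((flip s 1 - m) * w1 + - m' * w2) ->
      (r i).2 = (r j).2 + (- n * w1 + (flip s 1 - n') * w2) -> i = j).
Proof.
have D : (flip s 1 - m) * (flip s 1 - n') - - m' * - n = - flip s (m + n').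
  by have := shape_det sh; case: s => /=; lia.
apply: lattice_transversal; rewrite D; first by case: s {D} => /=; lia.
by rewrite /trace_abs; case: s {D} => /=; lia.
Qed.

Lemma vector_injective (s : bool) w1 w2 :
  (flip s 1 - m) * w1 + - m' * w2 = 0 -> - n * w1 + (flip s 1 - n') * w2 = 0 ->
  w1 = 0 /\ w2 = 0.
Proof.
apply: det_injective.
have -> : (flip s 1 - m) * (flip s 1 - n') - - m' * - n = - flip s (m + n').
  by have := shape_det sh; case: s => /=; lia.
by case: s => /=; lia.
Qed.

Lemma twists_even_vector g g' h : twists h g g' -> odd_part h = false ->
  ec g = ec g' + ((flip (odd_part g) 1 - m) * ec h + - m' * ed h) /\
  ed g = ed g' + (- n * ec h + (flip (odd_part g) 1 - n') * ed h).
Proof.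
move=> /(twisted_vector sh)[+ +] oh; rewrite oh /=.
by case: (odd_part g) => /=; lia.
Qed.

Variable r : bool -> 'I_trace_abs -> int * int.
Hypothesis r_cover : forall s c d, exists i w1 w2,
      c = (r s i).1 + ((flip s 1 - m) * w1 + - m' * w2) /\
      d = (r s i).2 + (- n * w1 + (flip s 1 - n') * w2).
Hypothesis r_sep : forall s i j w1 w2,
      (r s i).1 = (r s j).1 + ((flip s 1 - m) * w1 + - m' * w2) ->
      (r s i).2 = (r s j).2 + (- n * w1 + (flip s 1 - n') * w2) -> i = j.

Definition rep_index : finType := (bool * 'I_trace_abs * bool * bool)%type.
Definition bit (b : bool) : int := if b then 1 else 0.
Definition rep (i : rep_index) : gam k :=
  let: (s, v, beta, xi) := i in Gam k s (bit xi) (bit beta) (r s v).1 (r s v).2.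

(** Three even elements in turn bring the vector into the transversal and then,
   leaving the vector unchanged, the exponents of e2 and e1 into {0, 1}. *)
Lemma twists_even_rep g : exists i h, odd_part h = false /\ twists h g (rep i).
Proof.
have [v [w1 [w2 [cE dE]]]] := r_cover (odd_part g) (ec g) (ed g).
have step g0 h : exists g1, twists h g0 g1.
  by exists (h^-1 * (g0 * phi h))%g; rewrite /twists mulVKg.
have halve (z : int) : exists (b : bool) (y : int), z = bit b + 2 * y.
  exists (odd (absz z)), ((z - bit (odd (absz z))) %/ 2)%Z.
  by rewrite /bit; case: ifP => ?; lia.
have [g1 t1] := step g (Gam k false 0 0 w1 w2).
have o1 := twisted_parity sh t1.
have [/= c1 d1] := twists_even_vector t1 erefl.
have [beta [y yE]] := halve (eb g1).
have [g2 t2] := step g1 (Gam k false 0 y 0 0).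
have [/= c2 d2] := twists_even_vector t2 erefl.
have [xi [x xE]] := halve (ex g2).
have [g3 t3] := step g2 (Gam k false x 0 0 0).
have [/= c3 d3] := twists_even_vector t3 erefl.
have o2 := twisted_parity sh t2; have o3 := twisted_parity sh t3.
exists (odd_part g, v, beta, xi).
exists ((Gam k false 0 0 w1 w2 * Gam k false 0 y 0 0) * Gam k false x 0 0 0)%g.
split=> //; have -> : rep (odd_part g, v, beta, xi) = g3; last first.
  exact: twists_trans (twists_trans t1 t2) t3.
have h2 := twisted_height sh t2; have h3 := twisted_height sh t3.
have x3 : ex g2 - x = x + ex g3.
  move: t3; rewrite /twists (shape_e1 sh) => /(congr1 (@ex k)).
  by case: (g2) => s ? ? ? ?; case: (g3) => s' ? ? ? ?; rewrite !gmulE /=; case: s; case: s' => /=; lia.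
rewrite /rep; move: o1 o2 o3 c1 d1 c2 d2 c3 d3 h2 h3 x3 yE xE cE dE; rewrite /height.
case: (g3) => s3 x3' b3 c3' d3' /= -> -> -> *; apply: Gam_eq; lia.
Qed.

Lemma rep_even_injective i j h : odd_part h = false -> twists h (rep i) (rep j) -> i = j.
Proof.
case: i => -[[s v] beta] xi; case: j => -[[s' v'] beta'] xi' oh t.
have := twisted_parity sh t; rewrite /= => ss'; rewrite -ss' in t *.
have [/= cE dE] := twists_even_vector t oh.
have vv := r_sep cE dE; rewrite -vv in cE dE t *.
have [c0 d0] : ec h = 0 /\ ed h = 0.
  by apply: (@vector_injective s); lia.
have hE := twisted_height sh t; rewrite /height /= c0 in hE.
have b0 : eb h = 0 by move: hE; rewrite /bit; case: beta t; case: beta' => /=; lia.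
have bb : beta = beta' by move: hE; rewrite b0 /bit; case: beta t; case: beta' => /=; lia.
have {}hE : h = Gam k false (ex h) 0 0 0.
  by move: oh b0 c0 d0; case: (h) => ? ? ? ? ? /= -> -> -> ->.
move: t; rewrite /twists hE (shape_e1 sh) !gmulE => /(congr1 (@ex k)) /= xx.
have -> : xi = xi'.
  by move: xx; rewrite /bit; case: (s); case: xi; case: xi' => /=; lia.
by rewrite bb.
Qed.

(** One representative is reached by even h and the other by odd h; they differ
   because an odd h fixes nothing. *)
Lemma twisted_class_two_reps g :
  #|[set i : rep_index | `[< twisted_conj phi g (rep i) >] ]%SET| = 2%N.
Proof.
have [i0 [h0 [o0 t0]]] := twists_even_rep g.
pose al := gam_gen k Alpha.
have t1 : twists al g (al^-1 * (g * phi al))%g by rewrite /twists mulVKg.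
have [i1 [h1 [o1 t1']]] := twists_even_rep (al^-1 * (g * phi al))%g.
have {t1 t1'} t1 := twists_trans t1 t1'.
have neq : i0 != i1.
  apply/eqP => ii; rewrite ii in t0; apply: (odd_no_fixpoint _ (twists_comp t0 t1)).
  by rewrite !odd_partM odd_partV o0 o1.
have -> : [set i : rep_index | `[< twisted_conj phi g (rep i) >] ]%SET = [set i0; i1]%SET.
  apply/setP => i; rewrite !inE; apply/asboolP/orP; last first.
    by case=> /eqP ->; apply/twisted_conjP; [exists h0|exists (al * h1)%g].
  move=> /twisted_conjP[h t]; case oh: (odd_part h); [right|left].
    apply/eqP/esym/(rep_even_injective _ (twists_comp t1 t)).
    by rewrite !odd_partM odd_partV odd_partM o1 oh.
  apply/eqP/esym/(rep_even_injective _ (twists_comp t0 t)).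
  by rewrite odd_partM odd_partV o0 oh.
by rewrite cards2 neq.
Qed.
End FiniteCount.

Lemma reidemeister_number_trace k (phi : {multiplicative gam k -> gam k})
    a1 a2 m m' n n' :
  aut_shape phi (- 1) (- 1) a1 a2 m m' n n' -> m + n' != 0 ->
  reidemeister_number phi = Some (4 * absz (m + n')%R)%N.
Proof.
move=> sh tr0; have [r rP] := choice (vector_transversal sh tr0).
have two := twisted_class_two_reps sh tr0 (fun s => (rP s).1) (fun s => (rP s).2).
have [//|N -> NE] := reidemeister_number_transversal _ two.
congr Some; move: NE; rewrite !card_prod !card_bool card_ord /trace_abs; lia.
Qed.

(** * Realizing every multiple of eight *)

Section Realization.
Variables (k t : nat).

Definition binom2 (c : int) : int := (c * (c - 1) %/ 2)%Z.

Lemma binom2E c : 2 * binom2 c = c * (c - 1).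
Proof.
have : (2 %| c * (c - 1))%Z by rewrite dvdzE abszM dvdn2 oddM; lia.
by move=> /divzK <-; rewrite /binom2 mulrC.
Qed.

Lemma binom2D c c' : binom2 (c + c') = binom2 c + binom2 c' + c * c'.
Proof. by have := binom2E (c + c'); have := binom2E c; have := binom2E c'; lia. Qed.

Lemma binom2N c : binom2 (- c) = binom2 c + c.
Proof. by have := binom2E (- c); have := binom2E c; lia. Qed.

(** The e1-exponent that the e2, e3, e4-part of an element acquires when
   e2 is sent to e1^(k t) e2^-1, e3 to e2 e3 e4^t and e4 to
   e1^(k (2 t - 1)) e2 e3^2 e4^(2 t - 1). *)
Definition e1_exponent (b c d : int) : int :=
  k%:Z * (t%:Z * b + t%:Z * binom2 c + (2 * t%:Z - 1) * (d * d) + 2 * t%:Z * (c * d)).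

(** Here e1 and alpha go to their inverses; the final - 1 is the e1-exponent of
   alpha^-1 = e1^-1 alpha. *)
Definition realize_fun (g : gam k) : gam k :=
  Gam k (odd_part g)
    (- ex g + e1_exponent (eb g) (ec g) (ed g) - (if odd_part g then 1 else 0))
    (- eb g + ec g + ed g) (ec g + 2 * ed g) (t%:Z * ec g + (2 * t%:Z - 1) * ed g).

Lemma realize_funM : {morph realize_fun : g h / (g * h)%g}.
Proof.
move=> [s x b c d] [s' x' b' c' d']; rewrite /realize_fun /e1_exponent !gmulE.
by case: s; case: s'; apply: Gam_eq => //=; rewrite ?binom2D ?binom2N; ring.
Qed.

HB.instance Definition _ :=
  isMultiplicative.Build (gam k) (gam k) realize_fun realize_funM.

Lemma realize_fun_bij : bijective realize_fun.
Proof.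
pose c_ (g : gam k) := (1 - 2 * t%:Z) * ec g + 2 * ed g.
pose d_ (g : gam k) := t%:Z * ec g - ed g.
pose b_ (g : gam k) := c_ g + d_ g - eb g.
exists (fun g => Gam k (odd_part g)
  (- ex g + e1_exponent (b_ g) (c_ g) (d_ g) - (if odd_part g then 1 else 0))
  (b_ g) (c_ g) (d_ g)) => g.
  have cE : c_ (realize_fun g) = ec g by rewrite /c_ /=; ring.
  have dE : d_ (realize_fun g) = ed g by rewrite /d_ /=; ring.
  have bE : b_ (realize_fun g) = eb g by rewrite /b_ cE dE /=; ring.
  rewrite cE dE bE; case: g {cE dE bE} => s x b c d.
  by apply: Gam_eq => //=; ring.
rewrite /realize_fun /=; case: g => s x b c d.
by apply: Gam_eq => //=; rewrite /b_ /c_ /d_ /=; ring.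
Qed.

Lemma reidemeister_number_realize : (0 < k)%N -> (0 < t)%N ->
  reidemeister_number realize_fun = Some (8 * t)%N.
Proof.
move=> k0 t0.
have [eps [delta [a1 [a2 [m [m' [n [n' sh]]]]]]]] := automorphism_shape k0 realize_fun_bij.
have eps1 : eps = - 1.
  by have := shape_height sh (gam_gen k E3); rewrite /height /=; lia.
have delta1 : delta = - 1.
  have := congr1 (@ex k) (shape_e1 sh 1); have := binom2E 0.
  by rewrite /= /e1_exponent mulr1 mul0r => /eqP; rewrite mulf_eq0 => /eqP -> //; lia.
have mE : m = 1 by have := shape_c sh (gam_gen k E3); rewrite /=; lia.
have n'E : n' = 2 * t%:Z - 1 by have := shape_d sh (gam_gen k E4); rewrite /=; lia.
rewrite eps1 delta1 in sh; rewrite (reidemeister_number_trace sh); last by lia.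
by congr Some; lia.
Qed.

End Realization.

Lemma reidemeister_spectrum_gam (k : nat) : (0 < k)%N ->
  reidemeister_spectrum (gam k) =
    [set Some (8 * n)%N | n in [set n : nat | (0 < n)%N]] `|` [set None].
Proof.
move=> k0; apply/seteqP; split=> R.
  move=> [phi phi_bij <-].
  have [eps [delta [a1 [a2 [m [m' [n [n' sh]]]]]]]] := automorphism_shape k0 phi_bij.
  case: (shape_eps sh) => eps1.
    by right; exact: infinite_height sh eps1.
  case: (shape_delta sh) => delta1.
    by right; exact: infinite_central sh delta1 eps1.
  rewrite eps1 delta1 in sh; have [tr0|tr0] := eqVneq (m + n') 0.
    right; apply: (infinite_singular (s := false) sh).
    by have := shape_det sh; rewrite /=; lia.
  left; have [t tE] := trace_even sh.
  exists (absz t); first by rewrite /=; lia.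
  by rewrite (reidemeister_number_trace sh tr0) tE; congr Some; lia.
move=> [[t t0 <-]|->].
  by exists (@realize_fun k t); [exact: realize_fun_bij|exact: reidemeister_number_realize].
exists idfun; first by exists idfun.
have idfun_bij : bijective (idfun : gam k -> gam k) by exists idfun.
have [eps [delta [a1 [a2 [m [m' [n [n' sh]]]]]]]] := automorphism_shape k0 idfun_bij.
apply: (infinite_height sh).
by have := shape_height sh (gam_gen k E3); rewrite /height /=; lia.
Qed.

Local Close Scope ring_scope.

Theorem mainTheorem4 (k : nat) (hk : 1 <= k) :
  reidemeister_spectrum (Gamma k) =
    [set Some (8 * n) | n in [set n : nat | 1 <= n]] `|` [set None].
Proof.
pose f : {multiplicative Gamma k -> gam k} := @to_gam k.
have f'M : {morph @of_gam k : g h / (g * h)%g}.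
  exact: (can2_gmulfM (f := f) (@to_gamK k) (@of_gamK k)).
pose f'_mult := isMultiplicative.Build (gam k) (Gamma k) (@of_gam k) f'M.
pose f' : {multiplicative gam k -> Gamma k} := HB.pack (@of_gam k) f'_mult.
rewrite (@reidemeister_spectrum_iso _ _ f f' (@to_gamK k) (@of_gamK k)).
exact: reidemeister_spectrum_gam.
Qed.
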